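(* Let $\mathcal{L}_O$ be the logic obtained by extending orthologic by a set of axioms $\{\phi_i\vdash\psi_i\}_{i}$, and let $\mathcal{L}_I$ be the logic obtained by extending (the implication-free fragment of) intuitionistic logic by a set of axioms $\{\chi_j\vdash\theta_j\}_{j}$, all formulas being in the signature $\{\wedge,\vee,\lnot\}$. Then the set of entailments valid in both $\mathcal{L}_O$ and $\mathcal{L}_I$ (i.e. $\mathcal{L}_O\cap\mathcal{L}_I$) is exactly the logic obtained by adding to fundamental logic the following axioms: (1) $\phi_i\vdash\lnot\lnot\psi_i$ for each $i$; (2) $\chi_j\vdash\theta_j\vee\lnot\theta_j$ for each $j$; (3) the axiom (Ex): $\lnot\big[a\wedge((b\wedge c)\vee(b\wedge d))\big]\wedge a\wedge(c\vee e)\wedge\lnot\lnot f \vdash \lnot\lnot(a\wedge f)\wedge\big[(a\wedge c)\vee(a\wedge e)\vee f\big]\wedge\big[(b\wedge(c\vee d))\vee\lnot(b\wedge(c\vee d))\big]$, where $a,b,c,d,e,f$ are propositional variables.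
   Context: Formulas are built from propositional variables and constants $\top,\bot$ using $\wedge,\vee,\lnot$ (no implication). An entailment is an expression $\varphi\vdash\psi$ of formulas; an entailment with empty left side $\vdash\psi$ means $\top\vdash\psi$. A fundamental lattice is a bounded lattice $(L,\wedge,\vee,0,1)$ with a unary operation $\lnot$ such that: $a\le b$ implies $\lnot b\le\lnot a$; $a\wedge\lnot a=0$; and $a\le\lnot\lnot a$, for all $a,b\in L$. A valuation assigns elements of $L$ to variables and extends to formulas homomorphically ($\top\mapsto1$, $\bot\mapsto0$). An entailment $\varphi\vdash\psi$ is valid in $L$ if $v(\varphi)\le v(\psi)$ for every valuation $v$ into $L$. An ortholattice is a fundamental lattice with $\lnot\lnot a=a$ for all $a$. A Heyting lattice is a distributive fundamental lattice in which $a\wedge b=0$ implies $b\le\lnot a$. Fundamental logic is the set of entailments valid in all fundamental lattices (equivalently the smallest relation $\vdash$ containing the introduction/elimination rules for $\wedge,\vee,\lnot$). For a set $\Gamma$ of entailments: ''fundamental logic extended by $\Gamma$'' is the set of entailments valid in every fundamental lattice in which all entailments of $\Gamma$ are valid; ''orthologic extended by $\Gamma$'' is the set of entailments valid in every ortholattice validating $\Gamma$; ''intuitionistic logic extended by $\Gamma$'' is the set of entailments valid in every Heyting lattice validating $\Gamma$. The logics $\mathcal{L}_O$ and $\mathcal{L}_I$ are assumed consistent, i.e. $\top\vdash\bot$ does not belong to them. *)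

(* Defs.v *)
From mathcomp Require Import all_boot all_order.
From mathcomp Require Import boolp classical_sets.

Set Implicit Arguments.
Unset Strict Implicit.
Unset Printing Implicit Defensive.

Import Order.LTheory.

Local Open Scope classical_set_scope.
Local Open Scope order_scope.

Inductive formula : Type :=
| Var of nat
| Top
| Bot
| And of formula & formula
| Or of formula & formula
| Neg of formula.

Declare Scope formula_scope.
Delimit Scope formula_scope with fml.
Bind Scope formula_scope with formula.
Notation "p /\ q" := (And p q) : formula_scope.
Notation "p \/ q" := (Or p q) : formula_scope.
Notation "~ p" := (Neg p) : formula_scope.

Record entailment : Type := Entails { lhs : formula; rhs : formula }.

Arguments Entails (lhs rhs)%_fml.
Notation "p |-- q" := (Entails p q) (at level 95, no associativity).

Record is_fundamental d (L : tbLatticeType d) (neg : L -> L) : Prop := {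
  neg_antitone : forall a b : L, a <= b -> neg b <= neg a;
  meet_neg : forall a : L, a `&` neg a = \bot;
  le_neg_neg : forall a : L, a <= neg (neg a)
}.

Record is_ortholattice d (L : tbLatticeType d) (neg : L -> L) : Prop := {
  ortho_fundamental : is_fundamental neg;
  neg_negK : forall a : L, neg (neg a) = a
}.

Record is_heyting d (L : tbLatticeType d) (neg : L -> L) : Prop := {
  heyting_fundamental : is_fundamental neg;
  heyting_meetUr : forall a b c : L, a `&` (b `|` c) = (a `&` b) `|` (a `&` c);
  heyting_pseudocompl : forall a b : L, a `&` b = \bot -> b <= neg a
}.

Fixpoint eval d (L : tbLatticeType d) (neg : L -> L) (v : nat -> L)
    (p : formula) : L :=
  match p with
  | Var n => v n
  | Top => \top
  | Bot => \bot
  | And q r => eval neg v q `&` eval neg v r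
  | Or q r => eval neg v q `|` eval neg v r
  | Neg q => neg (eval neg v q)
  end.

Definition valid d (L : tbLatticeType d) (neg : L -> L) (e : entailment) : Prop :=
  forall v : nat -> L, eval neg v (lhs e) <= eval neg v (rhs e).

(* Axioms are validated under all valuations, so they act as schemata: each of
   the three logics below is closed under uniform substitution. *)
Definition validates d (L : tbLatticeType d) (neg : L -> L)
    (G : set entailment) : Prop :=
  forall e, G e -> valid neg e.

Definition fundamental_logic_ext (G : set entailment) : set entailment :=
  [set e | forall d (L : tbLatticeType d) (neg : L -> L),
     is_fundamental neg -> validates neg G -> valid neg e].

Definition orthologic_ext (G : set entailment) : set entailment :=
  [set e | forall d (L : tbLatticeType d) (neg : L -> L),
     is_ortholattice neg -> validates neg G -> valid neg e].

Definition intuitionistic_logic_ext (G : set entailment) : set entailment :=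
  [set e | forall d (L : tbLatticeType d) (neg : L -> L),
     is_heyting neg -> validates neg G -> valid neg e].

Definition consistent (logic : set entailment) : Prop :=
  ~ logic (Top |-- Bot).

Definition Ex : entailment :=
  let a := Var 0 in let b := Var 1 in let c := Var 2 in
  let d := Var 3 in let e := Var 4 in let f := Var 5 in
  ~ (a /\ ((b /\ c) \/ (b /\ d))) /\ a /\ (c \/ e) /\ ~ ~ f
  |--
  ~ ~ (a /\ f) /\ ((a /\ c) \/ (a /\ e) \/ f)
    /\ ((b /\ (c \/ d)) \/ ~ (b /\ (c \/ d))).

(* Main.v *)
(** Both logics are consistent, so their axioms are classical tautologies and
    Glivenko's theorem makes the listed axioms valid in both logics. Conversely,
    let [L] be a fundamental lattice validating the axioms. By (Ex), [~ ~]
    preserves meets, so the kernel of [neg] is a congruence whose quotient is an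
    ortholattice. Also by (Ex), if [x <= neg (neg y)] and not [x <= y], then a
    filter containing [x] and maximal among those avoiding [y] is prime; and if
    [F] is a proper prime filter with [~ F (neg a)], then a maximal proper filter
    containing [F] and [a] is prime. Hence identifying the elements that lie in
    the same proper prime filters gives a Heyting quotient, and together the
    two quotients separate the points of [L]. *)

Require Import Defs.
From HB Require Import structures.
From mathcomp Require Import all_boot all_order.
From mathcomp Require Import boolp classical_sets.

Set Implicit Arguments.
Unset Strict Implicit.
Unset Printing Implicit Defensive.

Import Order.Theory.

Local Open Scope classical_set_scope.
Local Open Scope quotient_scope.
Local Open Scope order_scope.

(** * Morphisms and quotients *)

Record is_morphism d (L : tbLatticeType d) (neg : L -> L)
    d' (M : tbLatticeType d') (neg' : M -> M) (h : L -> M) : Prop := {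
  morphI : forall x y, h (x `&` y) = h x `&` h y;
  morphU : forall x y, h (x `|` y) = h x `|` h y;
  morph0 : h \bot = \bot;
  morph1 : h \top = \top;
  morphN : forall x, h (neg x) = neg' (h x)
}.

Lemma eval_morph d (L : tbLatticeType d) (neg : L -> L)
    d' (M : tbLatticeType d') (neg' : M -> M) (h : L -> M) v p :
  is_morphism neg neg' h -> eval neg' (h \o v) p = h (eval neg v p).
Proof.
move=> hm; elim: p => [n|||p IHp q IHq|p IHp q IHq|p IHp] //=.
- by rewrite (morph1 hm).
- by rewrite (morph0 hm).
- by rewrite IHp IHq (morphI hm).
- by rewrite IHp IHq (morphU hm).
- by rewrite IHp (morphN hm).
Qed.

Lemma morph_le d (L : tbLatticeType d) (neg : L -> L)
    d' (M : tbLatticeType d') (neg' : M -> M) (h : L -> M) :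
  is_morphism neg neg' h -> {homo h : x y / x <= y}.
Proof. by move=> hm x y /meet_idPl xy; apply/meet_idPl; rewrite -(morphI hm) xy. Qed.

Lemma surj_valuation (A B : Type) (h : A -> B) (v : nat -> B) :
  (forall y, exists x, h x = y) -> exists w, v = h \o w.
Proof.
move=> hs; have /choice[w hw] : forall n, exists x, h x = v n by move=> n; exact: hs.
by exists w; apply/funext => n /=; rewrite hw.
Qed.

Lemma surj_valid d (L : tbLatticeType d) (neg : L -> L)
    d' (M : tbLatticeType d') (neg' : M -> M) (h : L -> M) e :
  is_morphism neg neg' h -> (forall y, exists x, h x = y) ->
  valid neg e -> valid neg' e.
Proof.
move=> hm hs eL v; have [w ->] := surj_valuation v hs.
by rewrite !(eval_morph _ _ hm); apply: (morph_le hm); exact: eL.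
Qed.

Lemma surj_fundamental d (L : tbLatticeType d) (neg : L -> L)
    d' (M : tbLatticeType d') (neg' : M -> M) (h : L -> M) :
  is_morphism neg neg' h -> (forall y, exists x, h x = y) ->
  is_fundamental neg -> is_fundamental neg'.
Proof.
move=> hm hs fL; split.
- move=> a b; have [x <-] := hs a; have [y <-] := hs b => /meet_idPl xy.
  rewrite -xy -(morphI hm) -!(morphN hm); apply: (morph_le hm).
  by apply: (neg_antitone fL); rewrite leIr.
- move=> a; have [x <-] := hs a.
  by rewrite -(morphN hm) -(morphI hm) (meet_neg fL) (morph0 hm).
- move=> a; have [x <-] := hs a.
  by rewrite -!(morphN hm); apply: (morph_le hm); exact: (le_neg_neg fL).
Qed.

(** Presenting a congruence as the kernel of a map [k] serves both later quotients: one takes [k] to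
    be [neg], the other sends an element to the set of prime filters containing it. *)
Lemma kernel_quotient d (L : tbLatticeType d) (neg : L -> L) (T : Type)
    (k : L -> T) :
  (forall x x' y y', k x = k x' -> k y = k y' -> k (x `&` y) = k (x' `&` y')) ->
  (forall x x' y y', k x = k x' -> k y = k y' -> k (x `|` y) = k (x' `|` y')) ->
  (forall x x', k x = k x' -> k (neg x) = k (neg x')) ->
  exists (M : tbLatticeType d) (neg' : M -> M) (h : L -> M),
    [/\ is_morphism neg neg' h, (forall y, exists x, h x = y)
      & forall x y, h x = h y <-> k x = k y].
Proof.
move=> kI kU kN; pose r (x y : L) := `[< k x = k y >].
have r_refl : reflexive r by move=> x; apply/asboolP.
have r_sym : symmetric r by move=> x y; apply/asboolP/asboolP.
have r_trans : transitive r.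
  by move=> y x z /asboolP xy /asboolP yz; apply/asboolP; rewrite xy.
pose e := EquivRel r r_refl r_sym r_trans.
pose Q := {eq_quot e}; pose h (x : L) : Q := \pi x.
have hk x y : h x = h y <-> k x = k y.
  split=> [/eqmodP/asboolP //|xy]; exact/eqmodP/asboolP.
have hs y : exists x, h x = y by exists (repr y); exact: reprK.
have kr x : k (repr (h x)) = k x by apply/hk; exact: reprK.
pose mt (a b : Q) := h (repr a `&` repr b).
pose jn (a b : Q) := h (repr a `|` repr b).
pose ng (a : Q) := h (neg (repr a)).
have mtE x y : mt (h x) (h y) = h (x `&` y) by apply/hk/kI; exact: kr.
have jnE x y : jn (h x) (h y) = h (x `|` y) by apply/hk/kU; exact: kr.
have ngE x : ng (h x) = h (neg x) by apply/hk/kN; exact: kr.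
have mtC : commutative mt.
  by move=> a b; have [x <-] := hs a; have [y <-] := hs b; rewrite !mtE meetC.
have jnC : commutative jn.
  by move=> a b; have [x <-] := hs a; have [y <-] := hs b; rewrite !jnE joinC.
have mtA : associative mt.
  move=> a b c; have [x <-] := hs a; have [y <-] := hs b; have [z <-] := hs c.
  by rewrite !mtE meetA.
have jnA : associative jn.
  move=> a b c; have [x <-] := hs a; have [y <-] := hs b; have [z <-] := hs c.
  by rewrite !jnE joinA.
have jnKI b a : mt a (jn a b) = a.
  by have [x <-] := hs a; have [y <-] := hs b; rewrite jnE mtE joinKI.
have mtKU b a : jn a (mt a b) = a.
  by have [x <-] := hs a; have [y <-] := hs b; rewrite mtE jnE meetKU.
(* Reading the order off the meet makes the compatibility field of [POrder_isLattice] hold by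
   [erefl]. *)
pose le (a b : Q) := mt a b == a.
have le_refl : reflexive le.
  by move=> a; have [x <-] := hs a; rewrite /le mtE meetxx.
have le_anti : antisymmetric le.
  by move=> a b /andP[/eqP ab /eqP ba]; rewrite -ab mtC ba.
have le_trans : transitive le.
  by move=> b a c /eqP ab /eqP bc; rewrite /le -ab -mtA bc.
pose P1 := Order.Le_isPOrder.Build d Q le_refl le_anti le_trans.
pose O1 : porderType d := HB.pack Q P1.
pose P2 := Order.POrder_isLattice.Build d O1 mtC jnC mtA jnA jnKI mtKU
  (fun _ _ => erefl).
have le0 (a : O1) : (h \bot : O1) <= a.
  by have [x <-] := hs a; rewrite /Order.le /= /le mtE meet0x.
have le1 (a : O1) : a <= (h \top : O1).
  by have [x <-] := hs a; rewrite /Order.le /= /le mtE meetx1.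
pose P3 := Order.hasBottom.Build d O1 le0.
pose P4 := Order.hasTop.Build d O1 le1.
pose M : tbLatticeType d := HB.pack O1 P2 P3 P4.
by exists M, ng, h; split=> //; split.
Qed.

(** * Negation in fundamental lattices *)

Section Fundamental.
Variables (d : Order.disp_t) (L : tbLatticeType d) (neg : L -> L).
Hypothesis fL : is_fundamental neg.
Implicit Types x y z : L.

Lemma neg1 : neg \top = \bot.
Proof. by rewrite -(meet_neg fL \top) meet1x. Qed.

Lemma neg0 : neg \bot = \top.
Proof. by apply/le_anti; rewrite lex1 -neg1 (le_neg_neg fL). Qed.

Lemma neg3 x : neg (neg (neg x)) = neg x.
Proof.
by apply/le_anti; rewrite (le_neg_neg fL) (neg_antitone fL) // (le_neg_neg fL).
Qed.

Lemma negU x y : neg (x `|` y) = neg x `&` neg y.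
Proof.
apply/le_anti; rewrite lexI !(neg_antitone fL) ?leUl ?leUr //=.
apply: le_trans (le_neg_neg fL _) _; apply: (neg_antitone fL).
by rewrite leUx; apply/andP; split; apply: le_trans (le_neg_neg fL _) _;
  apply: (neg_antitone fL); rewrite ?leIl ?leIr.
Qed.

End Fundamental.

(** * Two-valued valuations and Glivenko's theorem *)

Fixpoint var_bound p :=
  match p with
  | Var n => n.+1
  | Top | Bot => 0
  | And q r | Or q r => maxn (var_bound q) (var_bound r)
  | Neg q => var_bound q
  end.

(* Kalmar's lemma. *)
Lemma le_eval_literals d (L : tbLatticeType d) (neg : L -> L)
    (v : nat -> L) (w : nat -> bool) m p :
  is_fundamental neg ->
  (forall i, (i < var_bound p)%N -> m <= if w i then v i else neg (v i)) ->
  m <= if eval negb w p then eval neg v p else neg (eval neg v p).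
Proof.
move=> fL; elim: p => [n|||p IHp q IHq|p IHp q IHq|p IHp] /= hm.
- exact: hm.
- exact: lex1.
- by rewrite (neg0 fL) lex1.
- have {}IHp := IHp (fun i ip => hm i (leq_trans ip (leq_maxl _ _))).
  have {}IHq := IHq (fun i iq => hm i (leq_trans iq (leq_maxr _ _))).
  rewrite andEbool; case: (eval negb w p) IHp => IHp /=; last first.
    by apply: le_trans IHp _; rewrite (neg_antitone fL) ?leIl.
  case: (eval negb w q) IHq => IHq; first by rewrite lexI IHp.
  by apply: le_trans IHq _; rewrite (neg_antitone fL) ?leIr.
- have {}IHp := IHp (fun i ip => hm i (leq_trans ip (leq_maxl _ _))).
  have {}IHq := IHq (fun i iq => hm i (leq_trans iq (leq_maxr _ _))).
  rewrite (negU fL) -[eval negb w p `|` _]/(_ || _); case: (eval negb w p) IHp => IHp /=.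
    by rewrite lexU2 ?IHp.
  case: (eval negb w q) IHq => IHq; last by rewrite lexI IHp.
  by rewrite lexU2 ?IHq ?orbT.
- have {IHp} := IHp hm; case: (eval negb w p) => //= IHp.
  exact: le_trans IHp (le_neg_neg fL _).
Qed.

(** An element disjoint from both [a] and [neg a] is bottom, so variables can be eliminated one at a
    time without excluded middle. An arbitrary lower bound [m] stands for the meet of the chosen
    literals. *)
Lemma bot_by_literals d (L : tbLatticeType d) (neg : L -> L) (v : nat -> L) n x :
  is_heyting neg ->
  (forall (w : nat -> bool) m,
    (forall i, (i < n)%N -> m <= if w i then v i else neg (v i)) ->
    x `&` m = \bot) ->
  x = \bot.
Proof.
move=> hL; elim: n => [|n IHn] hx.
  by rewrite -(meetx1 x) (hx xpredT).
apply: IHn => w m hm.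
have lit b : x `&` (m `&` if b then v n else neg (v n)) = \bot.
  apply: (hx (fun i => if i == n then b else w i)) => i; rewrite ltnS leq_eqVlt.
  by have [->|/= _ ilt] := eqVneq i n; rewrite (leIr, leIxl) ?hm.
(* By [lit], the left side lies below [neg (v n)] and below its negation. *)
apply/le_anti; rewrite le0x andbT -(meet_neg (heyting_fundamental hL) (neg (v n))).
rewrite lexI; apply/andP; split; apply: (heyting_pseudocompl hL);
  by rewrite meetC -meetA ?(lit true) ?(lit false).
Qed.

(** It suffices that [p] and [~ q] have meet bottom, which may be tested below each choice of
    literals. There Kalmar's lemma decides [p] and [q] as [w] does, and classical validity excludes
    [p] true with [q] false. *)
Lemma glivenko d (L : tbLatticeType d) (neg : L -> L) p q :
  is_heyting neg -> valid negb (p |-- q) -> valid neg (p |-- ~ ~ q).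
Proof.
move=> hL pq v /=; apply: (heyting_pseudocompl hL); rewrite meetC.
have fL := heyting_fundamental hL.
apply: (bot_by_literals hL (v := v) (n := maxn (var_bound p) (var_bound q))).
move=> w m hm; have := pq w; rewrite leEbool /=.
have := le_eval_literals fL (fun i ip => hm i (leq_trans ip (leq_maxl _ _))).
have := le_eval_literals fL (fun i iq => hm i (leq_trans iq (leq_maxr _ _))).
have bot (a b : L) : a `&` m <= b -> a `&` m <= neg b -> a `&` m = \bot.
  by move=> mb mnb; apply/le_anti; rewrite le0x -(meet_neg fL b) lexI mb mnb.
case: (eval negb w p) => mq mp.
  case: (eval negb w q) mq => // mq _.
  by apply: (bot _ (eval neg v q)); [exact: leIxr | exact/leIxl/leIr].
move=> _; apply: (bot _ (eval neg v p)); last exact: leIxr.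
exact/leIxl/leIl.
Qed.

(** Bottom and top form a copy of the two-element Boolean algebra; nontriviality makes this copy
    reflect the order. *)
Lemma nontrivial_valid_bool d (L : tbLatticeType d) (neg : L -> L) e :
  is_fundamental neg -> ~ valid neg (Top |-- Bot) -> valid neg e ->
  valid negb e.
Proof.
move=> fL nt eL w; pose h b : L := if b then \top else \bot.
have hm : is_morphism negb neg h.
  split=> //; first by case; case; rewrite /= ?(meet1x, meet0x).
    by case; case; rewrite /= ?(joinx1, join1x, joinxx, join0x).
  by case; rewrite /= ?(neg1 fL) ?(neg0 fL).
have := eL (h \o w); rewrite !(eval_morph _ _ hm) leEbool.
by case: (eval _ _ _) => //=; case: (eval _ _ _) => //= h10; case: nt.
Qed.

(** If [e] failed on [bool], every ortholattice validating [G] would be trivial, making the logic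
    inconsistent. *)
Lemma consistent_ortho_valid_bool (G : set entailment) e :
  consistent (orthologic_ext G) -> G e -> valid negb e.
Proof.
move=> con Ge; apply: contrapT => ne; apply: con => d L neg oL GL.
apply: contrapT => nt; apply: ne.
exact: nontrivial_valid_bool (ortho_fundamental oL) nt (GL e Ge).
Qed.

Lemma consistent_intuitionistic_valid_bool (G : set entailment) e :
  consistent (intuitionistic_logic_ext G) -> G e -> valid negb e.
Proof.
move=> con Ge; apply: contrapT => ne; apply: con => d L neg hL GL.
apply: contrapT => nt; apply: ne.
exact: nontrivial_valid_bool (heyting_fundamental hL) nt (GL e Ge).
Qed.

(** * (Ex) in ortholattices and Heyting lattices *)

Lemma ortho_joinN d (L : tbLatticeType d) (neg : L -> L) (x : L) :
  is_ortholattice neg -> x `|` neg x = \top.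
Proof.
move=> oL; have fL := ortho_fundamental oL.
by rewrite -(neg_negK oL (x `|` neg x)) (negU fL) (meet_neg fL) (neg0 fL).
Qed.

(** Excluded middle trivializes the last factor; as [~ ~ f] equals [f], the other two follow from
    [a] and [f]. *)
Lemma Ex_ortho d (L : tbLatticeType d) (neg : L -> L) :
  is_ortholattice neg -> valid neg Ex.
Proof.
move=> oL v /=; rewrite !(neg_negK oL) (ortho_joinN _ oL) meetx1.
rewrite !lexI -andbA; apply/and3P; split.
- by apply: leIxr; exact: leIl.
- by do 2 apply: leIxr; exact: leIr.
- by do 2 apply: lexUr; do 2 apply: leIxr; exact: leIr.
Qed.

Lemma Ex_heyting d (L : tbLatticeType d) (neg : L -> L) :
  is_heyting neg -> valid neg Ex.
Proof.
move=> hL v /=; have fL := heyting_fundamental hL.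
have bot x y : x <= y -> x <= neg y -> x = \bot.
  by move=> xy xny; apply/le_anti; rewrite le0x -(meet_neg fL y) lexI xy xny.
rewrite joinA -!(heyting_meetUr hL).
move: (v 0) (v 1) (v 2) (v 3) (v 4) (v 5) => a b c d' e f.
rewrite !lexI; apply/and3P; split.
- apply: (heyting_pseudocompl hL); apply: (bot _ (neg f)).
    apply: (heyting_pseudocompl hL); apply: (bot _ (a `&` f)).
      rewrite lexI leIl andbT; do 3 apply: leIxr; exact: leIl.
    by apply: leIxr; exact: leIl.
  by do 4 apply: leIxr.
- apply: lexUl; rewrite lexI; apply/andP; split; first by apply: leIxr; exact: leIl.
  by do 2 apply: leIxr; exact: leIl.
(* The left side is below [a] and below the negation of the meet of [a] and [y], hence disjoint from
   [y]. *)
- apply: lexUr; apply: (heyting_pseudocompl hL); set y := b `&` _.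
  apply: (bot _ (a `&` y)); last by apply: leIxr; exact: leIl.
  by rewrite lexI leIl andbT; do 2 apply: leIxr; exact: leIl.
Qed.

(** * Filters and prime filters *)

Record is_filter d (L : tbLatticeType d) (F : set L) : Prop := {
  filter_top : F \top;
  filter_up : forall x y, x <= y -> F x -> F y;
  filter_meet : forall x y, F x -> F y -> F (x `&` y)
}.

Record is_prime_filter d (L : tbLatticeType d) (F : set L) : Prop := {
  prime_filter : is_filter F;
  prime_proper : ~ F \bot;
  prime_join : forall x y, F (x `|` y) -> F x \/ F y
}.

Definition add_filter d (L : tbLatticeType d) (F : set L) (a : L) : set L :=
  [set z | exists2 x, F x & x `&` a <= z].

Lemma add_filterP d (L : tbLatticeType d) (F : set L) (a : L) :
  is_filter F ->
  [/\ is_filter (add_filter F a), F `<=` add_filter F a & add_filter F a a].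
Proof.
move=> fF; split.
- split.
  + by exists \top; [exact: filter_top | rewrite lex1].
  + by move=> x y xy [z Fz zx]; exists z => //; exact: le_trans xy.
  + move=> x y [z Fz zx] [t Ft ty]; exists (z `&` t); first exact: filter_meet.
    rewrite lexI; apply/andP; split.
      by apply: le_trans zx; rewrite leI2 ?leIl.
    by apply: le_trans ty; rewrite leI2 ?leIr.
- by move=> x Fx; exists x => //; exact: leIl.
- by exists \top; [exact: filter_top | rewrite leIr].
Qed.

(** By Zorn's lemma. Maximality is recorded in the form used to prove primality: adjoining any
    outside [c] forces [q]. *)
Lemma max_filter_avoiding d (L : tbLatticeType d) (F : set L) (q : L) :
  is_filter F -> ~ F q ->
  exists G : set L, [/\ is_filter G, F `<=` G, ~ G q
    & forall c, ~ G c -> exists2 x, G x & x `&` c <= q].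
Proof.
move=> fF Fq.
(* [F] is added to each candidate so that the empty chain is not a special case. *)
pose P (A : set L) := is_filter (F `|` A)%classic /\ ~ A q.
have [B BP|A [[fA Aq] Amax]] := @Zorn_bigcup L P.
  move=> Btot; split; last by move=> [A /BP[]].
  split.
  - by left; exact: filter_top.
  - move=> x y xy [Fx|[A BA Ax]]; first by left; exact: filter_up xy Fx.
    have [fA _] := BP A BA.
    have [Fy|Ay] := filter_up fA xy (or_intror Ax); first by left.
    by right; exists A.
  - have inA A x y : B A -> (F `|` A)%classic x -> (F `|` A)%classic y ->
        (F `|` \bigcup_(X in B) X)%classic (x `&` y).
      move=> BA Ax Ay; have [fA _] := BP A BA.
      by have [Fxy|Axy] := filter_meet fA Ax Ay; [left|right; exists A].
    move=> x y [Fx|[A BA Ax]] [Fy|[C BC Cy]].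
    + by left; exact: filter_meet.
    + by apply: (inA C) => //; [left|right].
    + by apply: (inA A) => //; [right|left].
    + have [AC|CA] := Btot A C BA BC.
        by apply: (inA C) => //; right => //; exact: AC.
      by apply: (inA A) => //; right => //; exact: CA.
exists (F `|` A)%classic; split=> [//||[/Fq|/Aq]//|c Gc].
  exact: subsetUl.
apply: contrapT => cq.
have [fG GG Gcc] := add_filterP c fA.
(* Were [q] still avoided after adjoining [c], this filter would properly enlarge [A]. *)
apply: (Amax (add_filter (F `|` A)%classic c)).
  split; first by move=> x Ax; apply: GG; right.
  by move=> /(_ c Gcc) Ac; apply: Gc; right.
split; last by move=> [x Gx xq]; apply: cq; exists x.
by rewrite (_ : (F `|` _)%classic = add_filter (F `|` A)%classic c) //;
  apply/setUidPr => x Fx; apply: GG; left.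
Qed.

(** * Consequences of (Ex) *)

Section ExTheory.
Variables (d : Order.disp_t) (L : tbLatticeType d) (neg : L -> L).
Hypotheses (fL : is_fundamental neg) (ExL : valid neg Ex).
Implicit Types a b c e f x y z : L.

Lemma ExE a b c d' e f :
  neg (a `&` ((b `&` c) `|` (b `&` d'))) `&` a `&` (c `|` e) `&` neg (neg f) <=
  neg (neg (a `&` f)) `&` ((a `&` c) `|` (a `&` e) `|` f)
    `&` ((b `&` (c `|` d')) `|` neg (b `&` (c `|` d'))).
Proof.
have := ExL (nth \bot [:: a; b; c; d'; e; f]).
by rewrite /Ex /= !meetA !joinA.
Qed.

(** With [b] bottom the negated bracket becomes top, and with [c], [e] top the disjunction
    disappears; the first factor on the right is kept. *)
Lemma Ex_negneg a f : a `&` neg (neg f) <= neg (neg (a `&` f)).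
Proof.
have := ExE a \bot \top \bot \top f.
rewrite !meet0x joinxx meetx0 (neg0 fL) joinxx meet1x meetx1 => h.
by apply: le_trans h _; rewrite -meetA leIl.
Qed.

Lemma Ex_distr a c e f :
  a `&` (c `|` e) `&` neg (neg f) <= (a `&` c) `|` (a `&` e) `|` f.
Proof.
have := ExE a \bot c \bot e f.
rewrite !meet0x joinxx meetx0 (neg0 fL) meet1x => h.
by apply: le_trans h _; rewrite leIxl // leIr.
Qed.

(** With the other variables top, the bracket is the meet of [a] and [b], so the left side is [a];
    the last factor is kept. *)
Lemma Ex_compl a b : a `&` b = \bot -> a <= b `|` neg b.
Proof.
move=> ab; have := ExE a b \top \top \top \top.
rewrite !(joinxx, meetx1) ab (neg0 fL) (neg1 fL) (neg0 fL) meet1x meetx1 => h.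
by apply: le_trans h _; rewrite leIr.
Qed.

Lemma Ex_em b c d' : b `&` c = \bot -> b `&` d' = \bot ->
  (b `&` (c `|` d')) `|` neg (b `&` (c `|` d')) = \top.
Proof.
move=> bc bd; have := ExE \top b c d' \top \top.
rewrite bc bd joinxx meetx0 joinx1 !meetx1 (neg1 fL) (neg0 fL) !meet1x => h.
by apply/le_anti; rewrite lex1; apply: le_trans h _; rewrite leIr.
Qed.

Lemma negnegI x y : neg (neg (x `&` y)) = neg (neg x) `&` neg (neg y).
Proof.
apply/le_anti; rewrite lexI.
rewrite !(neg_antitone fL _) ?leIl ?leIr //=.
(* [Ex_negneg] strips the double negation from [y], then from [x]; [neg3] absorbs the extra pair of
   negations. *)
apply: le_trans (Ex_negneg _ _) _; rewrite -(neg3 fL (neg (x `&` y))).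
do 2 apply: (neg_antitone fL).
by rewrite meetC (meetC x); exact: Ex_negneg.
Qed.

(** A filter containing [x] contains [neg (neg y)], so [Ex_distr] with [f := y] gives distributivity
    modulo [y] inside it. This makes a filter maximal among those avoiding [y] prime. *)
Lemma prime_filter_separation x y :
  x <= neg (neg y) -> ~ x <= y ->
  exists F : set L, [/\ is_prime_filter F, F x & ~ F y].
Proof.
move=> xnny xy; have ft : is_filter [set \top : L].
  split=> // [a b + /= a1|a b /= -> ->]; last exact: meetxx.
  by rewrite a1 le1x => /eqP.
have [fx _ xx] := add_filterP x ft.
have [|F [fF sF Fy Fmax]] := max_filter_avoiding (q := y) fx.
  by move=> [t ->]; rewrite meet1x.
have Fx : F x by exact: sF.
exists F; split=> //; split=> //.
  by move=> F0; apply: Fy; exact: (filter_up fF (le0x y)).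
move=> c e Fce; apply: contrapT => /not_orP[/Fmax[s Fs sc] /Fmax[t Ft te]].
apply: Fy; pose u := s `&` t.
apply: (@filter_up _ _ _ fF (u `&` (c `|` e) `&` neg (neg y))); last first.
  apply: filter_meet (filter_up fF xnny Fx) => //.
  by do 2 apply: filter_meet => //.
apply: le_trans (Ex_distr _ _ _ _) _; rewrite !leUx lexx andbT.
apply/andP; split.
  by apply: le_trans sc; rewrite leI2 ?leIl.
by apply: le_trans te; rewrite leI2 ?leIr.
Qed.

(** Supplies the extensions needed to read negation as Kripke forcing. [Ex_compl] makes the filter
    generated by [F] and [a] proper; [Ex_em] makes a maximal proper filter above it prime. *)
Lemma prime_filter_extension F a :
  is_prime_filter F -> ~ F (neg a) ->
  exists G : set L, [/\ is_prime_filter G, F `<=` G & G a].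
Proof.
move=> pF Fna; have fF := prime_filter pF.
have [fH FH Ha] := add_filterP a fF.
have [|G [fG sG G0 Gmax]] := max_filter_avoiding (q := \bot) fH.
  move=> [x Fx]; rewrite lex0 => /eqP xa.
  have [Fa|//] := prime_join pF (filter_up fF (Ex_compl xa) Fx).
  by apply: (prime_proper pF); rewrite -xa; exact: filter_meet.
have FG : F `<=` G by move=> x Fx; exact/sG/FH.
exists G; split=> //; last exact: sG.
split=> // c e Gce; apply: contrapT => /not_orP[/Gmax[s Gs sc] /Gmax[t Gt te]].
pose u := s `&` t.
have uc : u `&` c = \bot.
  by apply/eqP; rewrite -lex0; apply: le_trans sc; rewrite leI2 ?leIl.
have ue : u `&` e = \bot.
  by apply/eqP; rewrite -lex0; apply: le_trans te; rewrite leI2 ?leIr.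
have Gu : G (u `&` (c `|` e)) by do 2 apply: filter_meet => //.
(* By [Ex_em] the prime filter [F] decides the element in [Gu]. Accepting it puts [u] and one of
   [c], [e] in [F]; rejecting it contradicts [Gu]. *)
have := filter_top fF; rewrite -(Ex_em uc ue) => /(prime_join pF)[Fu|/FG Gnu].
  have Fu' : F u by apply: filter_up Fu => //; exact: leIl.
  have [Fc|Fe] := prime_join pF (filter_up fF (leIr _ _) Fu).
    by apply: (prime_proper pF); rewrite -uc; exact: filter_meet.
  by apply: (prime_proper pF); rewrite -ue; exact: filter_meet.
by apply: G0; rewrite -(meet_neg fL (u `&` (c `|` e))); exact: filter_meet.
Qed.

(** * The ortholattice quotient and the Heyting quotient *)

Lemma ortho_quotient :
  exists (M : tbLatticeType d) (neg' : M -> M) (h : L -> M),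
    [/\ is_ortholattice neg', is_morphism neg neg' h,
      (forall y : M, exists x, h x = y)
      & forall x y, h x = h y <-> neg x = neg y].
Proof.
have [x x' y y' xx' yy'|x x' y y' xx' yy'|x x' ->//|] :=
    @kernel_quotient _ L neg _ neg.
(* By [neg3] and [negnegI], the negation of a meet depends only on the negations of its
   arguments. *)
- by rewrite -(neg3 fL) negnegI xx' yy' -negnegI (neg3 fL).
- by rewrite !(negU fL) xx' yy'.
move=> M [neg' [h [hm hs hk]]]; exists M, neg', h; split=> //.
split; first exact: surj_fundamental hm hs fL.
by move=> a; have [x <-] := hs a; rewrite -!(morphN hm); apply/hk; rewrite (neg3 fL).
Qed.

Let prime_above x : set (set L) := [set F | is_prime_filter F /\ F x].

Let prime_aboveP x y : (forall F, is_prime_filter F -> F x <-> F y) <->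
  prime_above x = prime_above y.
Proof.
split=> [xy|xy F pF].
  by apply/seteqP; split=> F [pF Fx]; split=> //; exact/(xy F pF).
by split=> Fx; [have [] : prime_above y F by rewrite -xy
               |have [] : prime_above x F by rewrite xy].
Qed.

Let prime_meet F x y : is_prime_filter F -> F (x `&` y) <-> F x /\ F y.
Proof.
move=> pF; have fF := prime_filter pF; split=> [Fxy|[]]; last exact: filter_meet.
by split; apply: filter_up Fxy => //; rewrite ?leIl ?leIr.
Qed.

Let prime_joinP F x y : is_prime_filter F -> F (x `|` y) <-> F x \/ F y.
Proof.
move=> pF; have fF := prime_filter pF; split=> [|[]]; first exact: prime_join.
  by apply: filter_up => //; exact: leUl.
by apply: filter_up => //; exact: leUr.
Qed.

(** The Kripke clause for negation, with inclusion of prime filters as accessibility; it makes the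
    kernel of [prime_above] respect [neg]. *)
Let prime_neg F x : is_prime_filter F ->
  F (neg x) <-> forall G, is_prime_filter G -> F `<=` G -> ~ G x.
Proof.
move=> pF; split=> [Fnx G pG FG Gx|FG].
  apply: (prime_proper pG); rewrite -(meet_neg fL x).
  by apply: (filter_meet (prime_filter pG)) => //; exact: FG.
by apply: contrapT => /(prime_filter_extension pF)[G [pG + Gx]] => /(FG G pG).
Qed.

Lemma heyting_quotient :
  exists (M : tbLatticeType d) (neg' : M -> M) (h : L -> M),
    [/\ is_heyting neg', is_morphism neg neg' h,
      (forall y : M, exists x, h x = y)
      & forall x y, h x = h y <-> (forall F, is_prime_filter F -> F x <-> F y)].
Proof.
have [|||M [neg' [h [hm hs hk]]]] := @kernel_quotient _ L neg _ prime_above.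
- move=> x x' y y' /prime_aboveP xx' /prime_aboveP yy'; apply/prime_aboveP => F pF.
  by rewrite !prime_meet // xx' // yy'.
- move=> x x' y y' /prime_aboveP xx' /prime_aboveP yy'; apply/prime_aboveP => F pF.
  by rewrite !prime_joinP // xx' // yy'.
- move=> x x' /prime_aboveP xx'; apply/prime_aboveP => F pF.
  by rewrite !prime_neg //; split=> FG G pG sFG; [rewrite -xx'|rewrite xx'] => //; exact: FG.
have {}hk x y : h x = h y <-> (forall F, is_prime_filter F -> F x <-> F y).
  by rewrite hk prime_aboveP.
exists M, neg', h; split=> //; split.
- exact: surj_fundamental hm hs fL.
- move=> a b c; have [x <-] := hs a; have [y <-] := hs b; have [z <-] := hs c.
  rewrite -!(morphI hm) -!(morphU hm) -(morphI hm); apply/hk => F pF.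
  by rewrite !(prime_meet, prime_joinP) //; tauto.
- move=> a b; have [x <-] := hs a; have [y <-] := hs b.
  rewrite -(morphI hm) -(morph0 hm) => /hk xy; apply/meet_idPl.
  rewrite -(morphN hm) -(morphI hm); apply/hk => F pF.
  rewrite prime_meet //; split=> [[]//|Fy]; split=> //.
  (* A prime [G] above [F] with [x] in it would contain both [x] and [y], which [xy] forbids. *)
  apply/prime_neg => // G pG FG Gx; apply: (prime_proper pG); apply/(xy G pG).
  by apply/prime_meet => //; split=> //; exact: FG.
Qed.

End ExTheory.

(* The intersection of the two logics *)
Local Close Scope order_scope.

Theorem theorem1p2 (I J : Type) (phi psi : I -> formula) (chi theta : J -> formula) :
  consistent (orthologic_ext [set phi i |-- psi i | i in [set: I]]) ->
  consistent (intuitionistic_logic_ext [set chi j |-- theta j | j in [set: J]]) ->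
  orthologic_ext [set phi i |-- psi i | i in [set: I]]
    `&` intuitionistic_logic_ext [set chi j |-- theta j | j in [set: J]]
  = fundamental_logic_ext
      ([set phi i |-- ~ ~ psi i | i in [set: I]]
       `|` [set chi j |-- theta j \/ ~ theta j | j in [set: J]]
       `|` [set Ex]).
Proof.
move=> conO conI; apply/seteqP; split=> [e [eO eI]|e eF].
  move=> d L neg fL GL v.
  have ExL : valid neg Ex by apply: GL; right.
  have [M [neg' [h [oM hm hs hk]]]] := ortho_quotient fL ExL.
  have GO : validates neg' [set phi i |-- psi i | i in [set: I]].
    move=> _ [i _ <-].
    have : valid neg' (phi i |-- ~ ~ psi i).
      by apply: surj_valid hm hs _; apply: GL; left; left; exists i.
    by move=> + w => /(_ w); rewrite /= (neg_negK oM).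
  have := eO _ _ _ oM GO (h \o v); rewrite !(eval_morph _ _ hm) => /meet_idPl.
  rewrite -(morphI hm) => /hk nst.
  (* The ortholattice quotient gives the inequality up to double negation, exactly what prime filter
     separation requires. *)
  have snnt : (eval neg v (lhs e) <= neg (neg (eval neg v (rhs e))))%O.
    apply: le_trans (le_neg_neg fL _) _; rewrite -nst.
    by do 2 apply: (neg_antitone fL); exact: leIr.
  apply: contrapT => st.
  have [F [pF Fs Ft]] := prime_filter_separation fL ExL snnt st.
  have [N [neg'' [k [hN km ks kk]]]] := heyting_quotient fL ExL.
  have GI : validates neg'' [set chi j |-- theta j | j in [set: J]].
    move=> _ [j _ <-] w /=.
    have : valid neg'' (chi j |-- theta j \/ ~ theta j).
      by apply: surj_valid km ks _; apply: GL; left; right; exists j.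
    (* After distributing, the disjunct with [~ theta j] is bottom, since Glivenko's theorem puts
       [chi j] below [~ ~ theta j]. *)
    move=> /(_ w) /= /meet_idPl <-; rewrite (heyting_meetUr hN) leUx leIr /=.
    have /(_ w) /= cnnt : valid neg'' (chi j |-- ~ ~ theta j).
      by apply: glivenko hN _; apply: consistent_intuitionistic_valid_bool conI _; exists j.
    apply: le_trans (le0x _).
    rewrite -(meet_neg (heyting_fundamental hN) (neg'' (eval neg'' w (theta j)))).
    by rewrite meetC leI2.
  have := eI _ _ _ hN GI (k \o v); rewrite !(eval_morph _ _ km) => /meet_idPl.
  rewrite -(morphI km) => /kk/(_ F pF)[_ /(_ Fs)] Fst.
  by apply: Ft; apply: filter_up Fst; [exact: prime_filter | exact: leIr].
split=> d L neg.
  move=> oL GL; apply: eF => [|_ [[[i _ <-]|[j _ <-]]|->]].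
  - exact: ortho_fundamental.
  - by move=> v /=; rewrite (neg_negK oL); apply: (GL (phi i |-- psi i)); exists i.
  - by move=> v /=; rewrite (ortho_joinN _ oL) lex1.
  - exact: Ex_ortho.
move=> hL GL; apply: eF => [|_ [[[i _ <-]|[j _ <-]]|->]].
- exact: heyting_fundamental.
(* Consistency of the orthologic makes its axioms classically valid, and Glivenko's theorem carries
   them to Heyting lattices. *)
- by apply: glivenko hL _; apply: consistent_ortho_valid_bool conO _; exists i.
- by move=> v /=; apply: lexUl; apply: (GL (chi j |-- theta j)); exists j.
- exact: Ex_heyting.
Qed.
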